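(* Let $k\to B$ be a homomorphism of associative, possibly non-unital rings, let $M$ be a $(B,k)$-bimodule and let $\varepsilon:M\to B$ be a $(B,k)$-bimodule map. Regard $M$ as a $k$-ring with multiplication $m\cdot m'=\varepsilon(m)m'$, and put $J=\varepsilon(M)$, $I=\ker\varepsilon$. Suppose that the surjective $(B,k)$-bimodule map $\varepsilon:M\to J$ admits a $k$-bimodule splitting. Then the $k$-ring $M$ is isomorphic to the $k$-bimodule $I\oplus J$ with multiplication $$(i,j)(i',j')=(ji'+\omega(j,j'),\,jj'),$$ where $\omega:J\otimes_kJ\to I$ is a $k$-bimodule map satisfying $$j\,\omega(j',j'')-\omega(jj',j'')+\omega(j,j'j'')=0\qquad (j,j',j''\in J).$$ If moreover $J$ has a $k$-central right unit (an element $e\in J$ with $je=j$ for all $j\in J$ and $ec=ce$ for all $c\in k$), then one can assume $\omega=0$, i.e. there is an isomorphism of $k$-rings $$M\cong\begin{pmatrix}J&I\\0&0\end{pmatrix}.$$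
   Context: Rings are associative and possibly non-unital. A $k$-ring is a $k$-bimodule $R$ with an associative multiplication given by a $k$-bimodule map $R\otimes_kR\to R$. $B$ is a $k$-ring via $k\to B$, and the $k$-bimodule structure on $M$ is obtained by restricting the left $B$-action along $k\to B$. $J$ is a left ideal and $k$-subring of $B$, and $I$ is an ideal of $M$ with $IM=0$; for $j\in J$ and $i\in I$, $ji$ denotes the left $B$-action on $M$ restricted to $J\subseteq B$ and $I$. The matrix notation denotes $J\oplus I$ with matrix multiplication, i.e. the product of the matrices with first rows $(j,i)$ and $(j',i')$ has first row $(jj',ji')$. *)

(* Defs.v *)
From HB Require Import structures.
From mathcomp Require Import all_boot all_algebra generic_quotient ring_quotient.
From mathcomp Require Import boolp.
From mathcomp Require Import freeg.

Set Implicit Arguments.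
Unset Strict Implicit.
Unset Printing Implicit Defensive.

Import GRing.Theory.
Local Open Scope ring_scope.
Local Open Scope quotient_scope.

Reserved Notation "x ** y" (at level 40, left associativity).
Reserved Notation "r *> x" (at level 40, left associativity).
Reserved Notation "x <* s" (at level 40, left associativity).

(* The ring structures of MathComp are all unital, so possibly non-unital     *)
(* associative rings are introduced here.                                     *)
HB.mixin Record Zmodule_isRng R of GRing.Zmodule R := {
  rmul : R -> R -> R;
  rmulA : associative rmul;
  rmulDl : left_distributive rmul +%R;
  rmulDr : right_distributive rmul +%R
}.

#[short(type="rngType")]
HB.structure Definition Rng := {R of Zmodule_isRng R & GRing.Zmodule R}.

Notation "x ** y" := (rmul x y) : ring_scope.

Record rngHom (R S : rngType) := RngHom {
  rngHom_fun :> R -> S;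
  rngHomD : {morph rngHom_fun : x y / x + y};
  rngHomM : {morph rngHom_fun : x y / x ** y}
}.

(* Bimodules are explicit records rather than a canonical structure because   *)
(* the same group carries several actions below (over B, and over k by        *)
(* restriction). There is no unitality condition: the rings have no units.    *)
Record bimod (R S : rngType) := Bimod {
  bimod_sort :> zmodType;
  lact : R -> bimod_sort -> bimod_sort;
  ract : bimod_sort -> S -> bimod_sort;
  lactDl : forall r r' x, lact (r + r') x = lact r x + lact r' x;
  lactDr : forall r x x', lact r (x + x') = lact r x + lact r x';
  lactM : forall r r' x, lact (r ** r') x = lact r (lact r' x);
  ractDl : forall x x' s, ract (x + x') s = ract x s + ract x' s;
  ractDr : forall x s s', ract x (s + s') = ract x s + ract x s';
  ractM : forall x s s', ract x (s ** s') = ract (ract x s) s';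
  lractA : forall r x s, ract (lact r x) s = lact r (ract x s)
}.

Notation "r *> x" := (lact r x) : ring_scope.
Notation "x <* s" := (ract x s) : ring_scope.

Record bihom (R S : rngType) (V W : bimod R S) := Bihom {
  bihom_fun :> V -> W;
  bihomD : {morph bihom_fun : x y / x + y};
  bihomL : forall r x, bihom_fun (r *> x) = r *> bihom_fun x;
  bihomR : forall x s, bihom_fun (x <* s) = bihom_fun x <* s
}.

Section BihomTheory.
Context (R S : rngType) (V W : bimod R S).

Lemma morph_zmod_morphism (U1 U2 : zmodType) (f : U1 -> U2) :
  {morph f : x y / x + y} -> zmod_morphism f.
Proof. by move=> fD x y; apply/eqP; rewrite eq_sym subr_eq -fD subrK. Qed.

HB.instance Definition _ (f : bihom V W) :=
  GRing.isZmodMorphism.Build V W f (morph_zmod_morphism (@bihomD _ _ _ _ f)).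

Lemma bihom0_morph : {morph (fun _ : V => 0 : W) : x y / x + y}.
Proof. by move=> x y; rewrite addr0. Qed.

Lemma lact0 (U : bimod R S) r : r *> (0 : U) = 0.
Proof. by apply: (@addrI U (r *> 0)); rewrite -lactDr !addr0. Qed.

Lemma ract0 (U : bimod R S) s : (0 : U) <* s = 0.
Proof. by apply: (@addrI U (0 <* s)); rewrite -ractDl !addr0. Qed.

Definition bihom0 : bihom V W :=
  Bihom bihom0_morph (fun r _ => esym (lact0 W r)) (fun _ s => esym (ract0 W s)).

End BihomTheory.

Lemma lactB (R S : rngType) (V : bimod R S) r (x y : V) :
  r *> (x - y) = r *> x - r *> y.
Proof. exact: (morph_zmod_morphism (lactDr r)). Qed.

Lemma ractB (R S : rngType) (V : bimod R S) s (x y : V) :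
  (x - y) <* s = x <* s - y <* s.
Proof. exact: (morph_zmod_morphism (fun x y => ractDl x y s)). Qed.

Section Restriction.
Context (R' R S : rngType) (phi : rngHom R' R) (V : bimod R S).

Definition restr : bimod R' S.
Proof.
apply: (@Bimod R' S V (fun r x => phi r *> x) (fun x s => x <* s)).
- by move=> r r' x; rewrite rngHomD lactDl.
- by move=> r x x'; rewrite lactDr.
- by move=> r r' x; rewrite rngHomM lactM.
- exact: ractDl.
- exact: ractDr.
- exact: ractM.
- by move=> r x s; rewrite lractA.
Defined.

End Restriction.

(* R as an (R, S)-bimodule along phi : S -> R *)
Definition regular (S R : rngType) (phi : rngHom S R) : bimod R S.
Proof.
apply: (@Bimod R S R (fun r x => r ** x) (fun x s => x ** phi s)).
- by move=> r r' x; rewrite rmulDl.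
- by move=> r x x'; rewrite rmulDr.
- by move=> r r' x; rewrite rmulA.
- by move=> x x' s; rewrite rmulDl.
- by move=> x s s'; rewrite rngHomD rmulDr.
- by move=> x s s'; rewrite rngHomM rmulA.
- by move=> r x s; rewrite rmulA.
Defined.

Section DirectSum.
Context (R S : rngType) (V W : bimod R S).

Definition dsum : bimod R S.
Proof.
apply: (@Bimod R S (V * W)%type (fun r x => (r *> x.1, r *> x.2))
                                (fun x s => (x.1 <* s, x.2 <* s))).
- by move=> r r' x; rewrite !lactDl.
- by move=> r x x'; rewrite !lactDr.
- by move=> r r' x; rewrite !lactM.
- by move=> x x' s; rewrite !ractDl.
- by move=> x s s'; rewrite !ractDr.
- by move=> x s s'; rewrite !ractM.
- by move=> r x s; rewrite !lractA.
Defined.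

End DirectSum.

Section SubBimod.
Context (R S : rngType) (V : bimod R S) (P : zmodClosed V).

Definition sub_sort : Type := {x : V | x \in P}.
HB.instance Definition _ := SubType.on sub_sort.
HB.instance Definition _ := Choice.on sub_sort.
HB.instance Definition _ := [SubChoice_isSubZmodule of sub_sort by <:].

Context (PL : forall r x, x \in P -> r *> x \in P)
        (PR : forall x s, x \in P -> x <* s \in P).

Definition sub_lact (r : R) (x : sub_sort) : sub_sort :=
  exist _ (r *> val x) (PL r (valP x)).
Definition sub_ract (x : sub_sort) (s : S) : sub_sort :=
  exist _ (val x <* s) (PR s (valP x)).

Definition subbimod : bimod R S.
Proof.
apply: (@Bimod R S sub_sort sub_lact sub_ract).
- by move=> r r' x; apply: val_inj; rewrite /= lactDl.
- by move=> r x x'; apply: val_inj; rewrite /= lactDr.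
- by move=> r r' x; apply: val_inj; rewrite /= lactM.
- by move=> x x' s; apply: val_inj; rewrite /= ractDl.
- by move=> x s s'; apply: val_inj; rewrite /= ractDr.
- by move=> x s s'; apply: val_inj; rewrite /= ractM.
- by move=> r x s; apply: val_inj; rewrite /= lractA.
Defined.

End SubBimod.

Section KernelImage.
Context (R S : rngType) (V W : bimod R S) (f : bihom V W).

Definition ker_pred : {pred V} := fun x => f x == 0.

Lemma ker_closed : zmod_closed ker_pred.
Proof.
split; first by rewrite unfold_in /ker_pred raddf0.
by move=> x y /eqP fx /eqP fy; apply/eqP; rewrite raddfB /= fx fy subr0.
Qed.
HB.instance Definition _ := GRing.isZmodClosed.Build V ker_pred ker_closed.

Lemma ker_lact r x : x \in ker_pred -> r *> x \in ker_pred.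
Proof. by rewrite !unfold_in /ker_pred bihomL => /eqP->; rewrite lact0. Qed.

Lemma ker_ract x s : x \in ker_pred -> x <* s \in ker_pred.
Proof. by rewrite !unfold_in /ker_pred bihomR => /eqP->; rewrite ract0. Qed.

Definition bker : bimod R S := subbimod ker_lact ker_ract.

Definition im_pred : {pred W} := fun y => `[< exists x, f x = y >].

Lemma im_closed : zmod_closed im_pred.
Proof.
split; first by apply/asboolP; exists 0; rewrite raddf0.
move=> _ _ /asboolP[x <-] /asboolP[y <-].
by apply/asboolP; exists (x - y); rewrite raddfB.
Qed.
HB.instance Definition _ := GRing.isZmodClosed.Build W im_pred im_closed.

Lemma im_lact r x : x \in im_pred -> r *> x \in im_pred.
Proof.
by move=> /asboolP[y <-]; apply/asboolP; exists (r *> y); rewrite bihomL.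
Qed.

Lemma im_ract x s : x \in im_pred -> x <* s \in im_pred.
Proof.
by move=> /asboolP[y <-]; apply/asboolP; exists (y <* s); rewrite bihomR.
Qed.

Definition bim : bimod R S := subbimod im_lact im_ract.

Lemma im_mem x : f x \in im_pred.
Proof. by apply/asboolP; exists x. Qed.

Definition corestr : bihom V bim.
Proof.
apply: (@Bihom R S V bim (fun x => exist _ (f x) (im_mem x))).
- by move=> x y; apply: val_inj; rewrite /= raddfD.
- by move=> r x; apply: val_inj; rewrite /= bihomL.
- by move=> x s; apply: val_inj; rewrite /= bihomR.
Defined.

End KernelImage.

(* The tensor product over a possibly non-unital ring S: the free abelian     *)
(* group on U * V modulo the subgroup generated by the usual relations.       *)
Section Tensor.
Context (R S T : rngType) (U : bimod R S) (V : bimod S T).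

Local Notation F := {freeg (U * V)%type}.
Local Notation gen x y := (<< (x, y) >> : F).

Inductive tens_rel : F -> Prop :=
| TensRelDl x x' y : tens_rel (gen (x + x') y - gen x y - gen x' y)
| TensRelDr x y y' : tens_rel (gen x (y + y') - gen x y - gen x y')
| TensRelA x s y : tens_rel (gen (x <* s) y - gen x (s *> y)).

Inductive tens_span : F -> Prop :=
| TensSpanRel z : tens_rel z -> tens_span z
| TensSpan0 : tens_span 0
| TensSpanB z z' : tens_span z -> tens_span z' -> tens_span (z - z').

Definition tens_pred : {pred F} := fun z => `[< tens_span z >].

Lemma tens_closed : zmod_closed tens_pred.
Proof.
split; first by apply/asboolP; exact: TensSpan0.
by move=> x y /asboolP xP /asboolP yP; apply/asboolP; exact: TensSpanB.
Qed.
HB.instance Definition _ := GRing.isZmodClosed.Build F tens_pred tens_closed.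

Definition tens_sort : zmodType := Quotient.quot tens_pred.

Definition pure (x : U) (y : V) : tens_sort := \pi_tens_sort (gen x y).

Lemma tens_relP z : tens_rel z -> \pi_tens_sort z = 0.
Proof.
move=> zP; rewrite -(raddf0 \pi_tens_sort); apply/eqP.
by rewrite -Quotient.idealrBE subr0; apply/asboolP/TensSpanRel.
Qed.

Lemma pureDl x x' y : pure (x + x') y = pure x y + pure x' y.
Proof.
have := tens_relP (TensRelDl x x' y); rewrite !raddfB -addrA -opprD.
by move/eqP; rewrite subr_eq0 => /eqP.
Qed.

Lemma pureDr x y y' : pure x (y + y') = pure x y + pure x y'.
Proof.
have := tens_relP (TensRelDr x y y'); rewrite !raddfB -addrA -opprD.
by move/eqP; rewrite subr_eq0 => /eqP.
Qed.

Lemma pureA x s y : pure (x <* s) y = pure x (s *> y).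
Proof.
have := tens_relP (TensRelA x s y); rewrite raddfB.
by move/eqP; rewrite subr_eq0 => /eqP.
Qed.

Lemma tens_ind (Q : tens_sort -> Prop) :
  (forall x y, Q (pure x y)) -> Q 0 ->
  (forall z z', Q z -> Q z' -> Q (z - z')) -> forall z, Q z.
Proof.
move=> Qp Q0 QB z; rewrite -[z]reprK; move: (repr z) => {z} D.
have QN x : Q x -> Q (- x) by move=> ?; rewrite -sub0r; apply: QB.
have QD x y : Q x -> Q y -> Q (x + y).
  by move=> Qx Qy; rewrite -[y]opprK; apply: QB => //; apply: QN.
rewrite -[D]freeg_sumE raddf_sum; apply: big_ind => //= -[x y] _.
have QM n : Q (pure x y *+ n) by elim: n => // n IH; rewrite mulrS; apply: QD.
have -> : << coeff (x, y) D *g (x, y) >> = gen x y *~ coeff (x, y) D.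
  by rewrite freegU_mulz intz.
rewrite raddfMz; case: (coeff _ _) => n; first exact: QM.
exact/QN/QM.
Qed.

Section Lift.
Context (W : zmodType) (f : U -> V -> W).

Definition tens_lift (z : tens_sort) : W :=
  fglift (fun p : U * V => f p.1 p.2 : zmodule W) (repr z).

Hypothesis fDl : forall x x' y, f (x + x') y = f x y + f x' y.
Hypothesis fDr : forall x y y', f x (y + y') = f x y + f x y'.
Hypothesis fA : forall x s y, f (x <* s) y = f x (s *> y).

Let g := fglift (fun p : U * V => f p.1 p.2 : zmodule W).

Let gB : {morph g : x y / x - y}.
Proof. exact: lift_is_additive. Qed.

Let gU x y : g (gen x y) = f x y.
Proof. by rewrite /g liftU scale1r. Qed.

Let g0 z : tens_span z -> g z = 0.
Proof.
elim=> [{}z []|| {}z z' _ IH _ IH'].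
- by move=> x x' y; rewrite !gB !gU fDl -addrA -opprD subrr.
- by move=> x y y'; rewrite !gB !gU fDr -addrA -opprD subrr.
- by move=> x s y; rewrite !gB !gU fA subrr.
- by rewrite -(subrr 0) gB subrr.
- by rewrite gB IH IH' subrr.
Qed.

Let g_pi z : tens_lift (\pi_tens_sort z) = g z.
Proof.
apply/eqP; rewrite -subr_eq0 -gB; apply/eqP/g0/asboolP.
have -> : `[< tens_span (repr (\pi_tens_sort z) - z) >]
        = (repr (\pi_tens_sort z) - z \in tens_pred) by [].
by rewrite Quotient.idealrBE reprK.
Qed.

Lemma tens_liftE x y : tens_lift (pure x y) = f x y.
Proof. by rewrite g_pi gU. Qed.

Lemma tens_liftB : {morph tens_lift : x y / x - y}.
Proof.
by move=> x y; rewrite -[x]reprK -[y]reprK -raddfB !g_pi gB.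
Qed.

Lemma tens_liftD : {morph tens_lift : x y / x + y}.
Proof.
have N x : tens_lift (- x) = - tens_lift x.
  by rewrite -sub0r tens_liftB -(subrr 0) tens_liftB subrr sub0r.
by move=> x y; rewrite -{1}[y]opprK tens_liftB N opprK.
Qed.

End Lift.

Lemma tens_ext (W : zmodType) (f g : tens_sort -> W) :
  {morph f : x y / x + y} -> {morph g : x y / x + y} ->
  (forall x y, f (pure x y) = g (pure x y)) -> f =1 g.
Proof.
move=> /morph_zmod_morphism fB /morph_zmod_morphism gB fg.
elim/tens_ind=> [//||z z' IH IH']; last by rewrite fB gB IH IH'.
by rewrite -(subrr 0) fB gB !subrr.
Qed.

Let lpure (r : R) (x : U) (y : V) := pure (r *> x) y.
Let rpure (t : T) (x : U) (y : V) := pure x (y <* t).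

Definition tens_lact (r : R) : tens_sort -> tens_sort := tens_lift (lpure r).
Definition tens_ract (z : tens_sort) (t : T) : tens_sort :=
  tens_lift (rpure t) z.

Lemma tens_lactD r : {morph tens_lact r : x y / x + y}.
Proof.
by apply: tens_liftD => [x x' y|x y y'|x s y];
  rewrite /lpure ?lactDr ?pureDl ?pureDr -?lractA ?pureA.
Qed.

Lemma tens_ractD t : {morph tens_ract^~ t : x y / x + y}.
Proof.
by apply: tens_liftD => [x x' y|x y y'|x s y];
  rewrite /rpure ?ractDl ?pureDl ?pureDr ?lractA ?pureA.
Qed.

Lemma tens_lactE r x y : tens_lact r (pure x y) = pure (r *> x) y.
Proof.
by apply: tens_liftE => [{}x x' {}y|{}x {}y y'|{}x s {}y];
  rewrite /lpure ?lactDr ?pureDl ?pureDr -?lractA ?pureA.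
Qed.

Lemma tens_ractE x y t : tens_ract (pure x y) t = pure x (y <* t).
Proof.
by apply: (tens_liftE (f := rpure t)) => [{}x x' {}y|{}x {}y y'|{}x s {}y];
  rewrite /rpure ?ractDl ?pureDl ?pureDr ?lractA ?pureA.
Qed.

Definition tens : bimod R T.
Proof.
apply: (@Bimod R T tens_sort tens_lact tens_ract).
- move=> r r'; apply: tens_ext => [|z z'|x y]; first exact: tens_lactD.
    by rewrite !tens_lactD addrACA.
  by rewrite !tens_lactE lactDl pureDl.
- exact: tens_lactD.
- move=> r r'; apply: tens_ext => [|z z'|x y]; first exact: tens_lactD.
    by rewrite !tens_lactD.
  by rewrite !tens_lactE lactM.
- by move=> z z' t; apply: tens_ractD.
- move=> z t t'; move: z; apply: tens_ext => [|z z'|x y].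
  + exact: tens_ractD.
  + by rewrite !tens_ractD addrACA.
  + by rewrite !tens_ractE ractDr pureDr.
- move=> z t t'; move: z; apply: tens_ext => [|z z'|x y].
  + exact: tens_ractD.
  + by rewrite !tens_ractD.
  + by rewrite !tens_ractE ractM.
- move=> r z t; move: z; apply: tens_ext => [z z'|z z'|x y].
  + by rewrite tens_lactD tens_ractD.
  + by rewrite tens_ractD tens_lactD.
  + by rewrite !(tens_lactE, tens_ractE).
Defined.

End Tensor.

Arguments tens {R S T} U V.
Arguments pure {R S T U V} x y.

Lemma pureL (R S T : rngType) (U : bimod R S) (V : bimod S T) r (x : U) (y : V) :
  pure (r *> x) y = r *> (pure x y : tens U V).
Proof. by rewrite -tens_lactE. Qed.

Lemma pureR (R S T : rngType) (U : bimod R S) (V : bimod S T) (x : U) (y : V) t :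
  pure x (y <* t) = (pure x y : tens U V) <* t.
Proof. by rewrite -tens_ractE. Qed.

Section TensorHom.
Context (R S T : rngType) (U : bimod R S) (V : bimod S T) (W : bimod R T).

Record balanced (f : U -> V -> W) : Prop := Balanced {
  balDl : forall x x' y, f (x + x') y = f x y + f x' y;
  balDr : forall x y y', f x (y + y') = f x y + f x y';
  balA : forall x s y, f (x <* s) y = f x (s *> y);
  balL : forall r x y, f (r *> x) y = r *> f x y;
  balR : forall x y t, f x (y <* t) = f x y <* t
}.

Section Hom.
Context (f : U -> V -> W) (fP : balanced f).

Let fD : {morph (tens_lift f : tens U V -> W) : x y / x + y} :=
  tens_liftD (balDl fP) (balDr fP) (balA fP).
Let fE x y : tens_lift f (pure x y) = f x y :=
  tens_liftE (balDl fP) (balDr fP) (balA fP) x y.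

Lemma tens_liftL r (z : tens U V) : tens_lift f (r *> z) = r *> tens_lift f z.
Proof.
move: z; apply: (@tens_ext R S T U V) => [z z'|z z'|x y].
- by rewrite lactDr fD.
- by rewrite fD lactDr.
- by rewrite -pureL !fE balL.
Qed.

Lemma tens_liftR (z : tens U V) t : tens_lift f (z <* t) = tens_lift f z <* t.
Proof.
move: z; apply: (@tens_ext R S T U V) => [z z'|z z'|x y].
- by rewrite ractDl fD.
- by rewrite fD ractDl.
- by rewrite -pureR !fE balR.
Qed.

Definition tens_hom : bihom (tens U V) W := Bihom fD tens_liftL tens_liftR.

Lemma tens_homE x y : tens_hom (pure x y) = f x y.
Proof. exact: fE. Qed.

End Hom.

End TensorHom.

Record krng (k : rngType) := KRng {
  krng_bimod :> bimod k k;
  krng_mul : bihom (tens krng_bimod krng_bimod) krng_bimod;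
  krng_mulA : associative (fun x y => krng_mul (pure x y))
}.

Definition kmul (k : rngType) (A : krng k) (x y : A) : A := krng_mul A (pure x y).

Definition krng_iso (k : rngType) (A A' : krng k) : Prop :=
  exists f : bihom A A', bijective f /\ {morph f : x y / kmul x y}.

Definition krng_of (k : rngType) (A : bimod k k) (mul : A -> A -> A)
  (mulP : balanced mul) (mulA : associative mul) : krng k.
Proof.
apply: (@KRng k A (tens_hom mulP)).
by move=> x y z; rewrite !tens_homE mulA.
Defined.

Lemma kmulE (k : rngType) (A : bimod k k) (mul : A -> A -> A)
  (mulP : balanced mul) (mulA : associative mul) (x y : A) :
  @kmul k (krng_of mulP mulA) x y = mul x y.
Proof. exact: tens_homE. Qed.

Section Extension.
Context (k B : rngType) (phi : rngHom k B) (M : bimod B k)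
        (eps : bihom M (regular phi)).

Definition M_mul (m m' : restr phi M) : restr phi M := (eps m : B) *> (m' : M).

Lemma M_mul_balanced : balanced M_mul.
Proof.
split; rewrite /M_mul.
- by move=> x x' y; rewrite raddfD lactDl.
- by move=> x y y'; rewrite lactDr.
- by move=> x s y; rewrite bihomR lactM.
- by move=> r x y; rewrite bihomL lactM.
- by move=> x y t; exact: esym (@lractA B k _ _ _ _).
Qed.

Lemma M_mulA : associative M_mul.
Proof. by move=> x y z; rewrite /M_mul bihomL /= lactM. Qed.

Definition M_krng : krng k := krng_of M_mul_balanced M_mulA.

Definition Jmod : bimod k k := restr phi (bim eps).
Definition Imod : bimod k k := restr phi (bker eps).

(* J is a subset of B and a left ideal: its product is the product of B, and  *)
(* it acts on I through the left B-action.                                    *)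
Definition Jval (j : Jmod) : B := val (j : sub_sort _).
Definition Jmul (j j' : Jmod) : Jmod := Jval j *> (j' : bim eps).
Definition Jact (j : Jmod) (i : Imod) : Imod := Jval j *> (i : bker eps).

Lemma JvalM j j' : Jval (Jmul j j') = Jval j ** Jval j'.
Proof. by []. Qed.

Lemma JvalD j j' : Jval (j + j') = Jval j + Jval j'.
Proof. by []. Qed.

Lemma JvalL c (j : Jmod) : Jval (c *> j) = phi c ** Jval j.
Proof. by []. Qed.

Lemma JvalR (j : Jmod) c : Jval (j <* c) = Jval j ** phi c.
Proof. by []. Qed.

Lemma JactE j i : val (Jact j i : sub_sort _) = Jval j *> (val (i : sub_sort _) : M).
Proof. by []. Qed.

Lemma Jmul_balanced : balanced Jmul.
Proof.
split; rewrite /Jmul.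
- by move=> x x' y; rewrite JvalD lactDl.
- by move=> x y y'; rewrite lactDr.
- by move=> x s y; rewrite JvalR lactM.
- by move=> r x y; rewrite JvalL lactM.
- by move=> x y t; exact: esym (@lractA B k _ _ _ _).
Qed.

Lemma Jact_balanced : balanced Jact.
Proof.
split; rewrite /Jact.
- by move=> x x' y; rewrite JvalD lactDl.
- by move=> x y y'; rewrite lactDr.
- by move=> x s y; rewrite JvalR lactM.
- by move=> r x y; rewrite JvalL lactM.
- by move=> x y t; exact: esym (@lractA B k _ _ _ _).
Qed.

Lemma JmulA : associative Jmul.
Proof. by move=> x y z; exact: esym (@lactM B k (bim eps) _ _ z). Qed.

Lemma JactM j j' i : Jact (Jmul j j') i = Jact j (Jact j' i).
Proof. exact: (@lactM B k (bker eps)). Qed.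

Definition cocycle (w : bihom (tens Jmod Jmod) Imod) : Prop :=
  forall j j' j'', Jact j (w (pure j' j'')) - w (pure (Jmul j j') j'')
                   + w (pure j (Jmul j' j'')) = 0.

Section Twisted.
Context (w : bihom (tens Jmod Jmod) Imod).

Definition twisted_mul (x y : dsum Imod Jmod) : dsum Imod Jmod :=
  (Jact x.2 y.1 + w (pure x.2 y.2), Jmul x.2 y.2).

Lemma twisted_mul_balanced : balanced twisted_mul.
Proof.
split; rewrite /twisted_mul /=.
- move=> x x' y; rewrite (balDl Jact_balanced) (balDl Jmul_balanced).
  by rewrite pureDl raddfD addrACA.
- move=> x y y'; rewrite (balDr Jact_balanced) (balDr Jmul_balanced).
  by rewrite pureDr raddfD addrACA.
- move=> x s y; rewrite (balA Jact_balanced) (balA Jmul_balanced).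
  by rewrite pureA.
- move=> r [i j] [i' j']; apply: congr2 (balL Jmul_balanced _ _ _).
  have := balL Jact_balanced r j i'; rewrite /= => ->.
  by rewrite pureL (bihomL w); exact: esym (lactDr (b := Imod) _ _ _).
- move=> [i j] [i' j'] t; apply: congr2 (balR Jmul_balanced _ _ _).
  have := balR Jact_balanced j i' t; rewrite /= => ->.
  by rewrite pureR (bihomR w); exact: esym (ractDl (b := Imod) _ _ _).
Qed.

Hypothesis wP : cocycle w.

Lemma twisted_mulA : associative twisted_mul.
Proof.
move=> [i j] [i' j'] [i'' j'']; rewrite /twisted_mul /= JmulA.
congr pair; rewrite (balDr Jact_balanced) JactM -!addrA; congr (_ + _).
have /eqP := wP j j' j''; rewrite addrAC subr_eq0 => /eqP.
by [].
Qed.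

Definition twisted : krng k := krng_of twisted_mul_balanced twisted_mulA.

End Twisted.

Lemma cocycle0 : cocycle (bihom0 (tens Jmod Jmod) Imod).
Proof. by move=> j j' j''; rewrite /= /Jact lact0 subr0 addr0. Qed.

(* The pair (j, i) stands for the 2 x 2 matrix with rows (j, i) and (0, 0).   *)
Definition matrix_mul (x y : dsum Jmod Imod) : dsum Jmod Imod :=
  (Jmul x.1 y.1, Jact x.1 y.2).

Lemma matrix_mul_balanced : balanced matrix_mul.
Proof.
have [aDl aDr aA aL aR] := Jact_balanced.
have [mDl mDr mA mL mR] := Jmul_balanced.
split; rewrite /matrix_mul /=.
- by move=> x x' y; rewrite aDl mDl.
- by move=> x y y'; rewrite aDr mDr.
- by move=> x s y; rewrite aA mA.
- by move=> r x y; rewrite aL mL.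
- by move=> x y t; rewrite aR mR.
Qed.

Lemma matrix_mulA : associative matrix_mul.
Proof. by move=> x y z; rewrite /matrix_mul /= JmulA JactM. Qed.

Definition matrix_krng : krng k := krng_of matrix_mul_balanced matrix_mulA.

Definition central_right_unit (e : Jmod) : Prop :=
  (forall j : Jmod, Jmul j e = j) /\ (forall c : k, e <* c = c *> e).

End Extension.

(* Main.v *)
Require Import Defs.
From mathcomp Require Import all_boot all_algebra.

(* A splitting s identifies M with I + J through m = i + s j, where j = eps m, *)
(* and (i + s j)(i' + s j') = j i' + j (s j') has image j j' in J: the product *)
(* is twisted by the defect w(j, j') = j (s j') - s (j j') of left             *)
(* J-linearity of s, and the cocycle identity is the associativity of the      *)
(* J-action. With a k-central right unit e, the splitting j |-> j (s e) is     *)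
(* left J-linear, and it is right k-linear because e commutes with k.          *)

Import GRing.Theory.
Local Open Scope ring_scope.

(** Everything depends on one comparison, [splitting_twisted_iso]: any splitting [s] gives mutually
    inverse [k]-bimodule maps between [M] and [I + J], and they carry the product of [M] to the one
    twisted by the failure of [s] to commute with the left action of [J]. It is applied twice. For
    the given [s], this failure is a bimodule map ([defect_balanced]) and a cocycle
    ([defect_cocycle]). Given a [k]-central right unit, [s] is replaced by a left [J]-linear
    splitting ([unit_splitting_linear]), whose failure is zero. *)

Section Splitting.
Context {k B : rngType} {phi : rngHom k B} {M : bimod B k}.
Context {eps : bihom M (regular phi)}.

Local Notation I := (Imod eps).
Local Notation J := (Jmod eps).
Local Notation N := (restr phi M).

Definition splitting (s : bihom J N) : Prop :=
  forall j : J, corestr eps (s j) = j.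

Definition Ival (i : I) : M := val (i : sub_sort _).

Lemma Ival_inj : injective Ival.
Proof. exact: val_inj. Qed.

Lemma eps_Ival i : eps (Ival i) = 0.
Proof. by apply/eqP; exact: (valP (i : sub_sort _)). Qed.

Lemma IvalD i i' : Ival (i + i') = Ival i + Ival i'.
Proof. by []. Qed.

Lemma IvalB i i' : Ival (i - i') = Ival i - Ival i'.
Proof. by []. Qed.

Lemma IvalL c (i : I) : Ival (c *> i) = phi c *> Ival i.
Proof. by []. Qed.

Lemma IvalR (i : I) c : Ival (i <* c) = Ival i <* c.
Proof. by []. Qed.

Definition to_I (m : M) (m0 : eps m = 0) : I := exist _ m (introT eqP m0).

Section Transport.
Context {s : bihom J N} (sK : splitting s).

Lemma eps_splitting j : eps (s j) = Jval j.
Proof. by rewrite -{2}(sK j). Qed.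

Lemma eps_sub_splitting (m : M) : eps (m - s (corestr eps m)) = 0.
Proof. by rewrite raddfB /= eps_splitting subrr. Qed.

Definition split_fun (m : N) : dsum I J :=
  (to_I _ (eps_sub_splitting m), corestr eps m).

Definition unsplit_fun (x : dsum I J) : N := Ival x.1 + s x.2.

Lemma split_funK : cancel split_fun unsplit_fun.
Proof. by move=> m; rewrite /unsplit_fun /= subrK. Qed.

Lemma corestr_unsplit x : corestr eps (unsplit_fun x) = x.2.
Proof.
rewrite /unsplit_fun (bihomD (corestr eps)) sK -[RHS]add0r; congr (_ + _).
by apply: val_inj; exact: eps_Ival.
Qed.

Lemma unsplit_funK : cancel unsplit_fun split_fun.
Proof.
move=> x; rewrite [RHS]surjective_pairing; apply: congr2.
  apply: Ival_inj.
  rewrite -[LHS]/(unsplit_fun x - s (corestr eps (unsplit_fun x))).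
  by rewrite corestr_unsplit addrK.
exact: corestr_unsplit.
Qed.

Lemma unsplit_funD : {morph unsplit_fun : x y / x + y}.
Proof. by move=> x y; rewrite /unsplit_fun /= (bihomD s) addrACA. Qed.

Lemma unsplit_funL c x : unsplit_fun (c *> x) = c *> unsplit_fun x.
Proof. by rewrite /unsplit_fun [in RHS]lactDr (bihomL s). Qed.

Lemma unsplit_funR x c : unsplit_fun (x <* c) = unsplit_fun x <* c.
Proof. by rewrite /unsplit_fun [in RHS]ractDl (bihomR s). Qed.

Definition split_hom : bihom N (dsum I J).
Proof.
apply: (@Bihom k k N (dsum I J) split_fun) => [x y|c x|x c];
  (* The inverse is visibly a bimodule map, being a sum of an inclusion and [s]; linearity passes
     back through it. *)
  apply: (can_inj unsplit_funK);
  by rewrite ?(unsplit_funD, unsplit_funL, unsplit_funR) !split_funK.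
Defined.

(** Keeping [w] arbitrary, subject only to its values, lets the lemma serve both for the defect of
    [s] and for the zero map. *)
Lemma splitting_twisted_iso (w : bihom (tens J J) I) (wP : cocycle w) :
  (forall j j', Ival (w (pure j j')) = (Jval j *> (s j' : M)) - s (Jmul j j')) ->
  krng_iso (M_krng eps) (twisted wP).
Proof.
move=> wE; exists split_hom; split.
  exact: (Bijective split_funK unsplit_funK).
move=> m m'; rewrite !kmulE; apply: (can_inj unsplit_funK).
(* With [j = eps m] and [m' = i' + s j'], the claim is [j m' = j i' + (j (s j') - s (j j')) + s (j
   j')]. *)
rewrite [LHS]split_funK /unsplit_fun /twisted_mul /= /M_mul.
rewrite IvalD wE addrA subrK [Ival _]JactE /= -lactDr.
by rewrite subrK.
Qed.

(** As [eps] is left [B]-linear and [s] is a section, both terms lie over [j j']. *)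
Lemma eps_defect j j' : eps ((Jval j *> (s j' : M)) - s (Jmul j j')) = 0.
Proof. by rewrite raddfB /= bihomL !eps_splitting subrr. Qed.

Definition defect j j' : I := to_I _ (eps_defect j j').

Lemma defectE j j' :
  Ival (defect j j') = (Jval j *> (s j' : M)) - s (Jmul j j').
Proof. by []. Qed.

(** Left [k]-linearity of [s] makes the defect balanced over [k]; right [k]-linearity of [s] gives
    that of the defect. *)
Lemma defect_balanced : balanced defect.
Proof.
have [mDl mDr mA mL mR] := Jmul_balanced eps.
split=> [x x' y|x y y'|x c y|c x y|x y c]; apply: Ival_inj.
- rewrite IvalD !defectE mDl JvalD lactDl (bihomD s).
  by rewrite opprD addrACA.
- rewrite IvalD !defectE mDr !(bihomD s) [_ *> (_ + _)]lactDr.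
  by rewrite opprD addrACA.
- by rewrite !defectE mA JvalR lactM (bihomL s).
- by rewrite IvalL !defectE mL JvalL lactM (bihomL s) lactB.
- rewrite IvalR !defectE mR !(bihomR s) [RHS]ractB.
  by rewrite [in RHS]lractA.
Qed.

Lemma defect_cocycle : cocycle (tens_hom defect_balanced).
Proof.
move=> j j' j''; rewrite !tens_homE; apply: Ival_inj.
rewrite IvalD IvalB [Ival (Jact _ _)]JactE !defectE JvalM lactM lactB JmulA.
(* Once the products in [J] are reassociated, each of the three terms [j (j' (s j''))],
   [j (s (j' j''))] and [s (j j' j'')] occurs twice with opposite signs. *)
by rewrite opprB [X in X + _]addrC !addrA !subrK subrr.
Qed.

End Transport.

Section RightUnit.
Context {s : bihom J N} (sK : splitting s).
Context {e : J} (eP : central_right_unit e).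

Definition unit_splitting_fun (j : J) : N := Jval j *> (s e : M).

Definition unit_splitting : bihom J N.
Proof.
apply: (@Bihom k k J N unit_splitting_fun); rewrite /unit_splitting_fun.
- by move=> x y; rewrite JvalD lactDl.
- by move=> c x; rewrite JvalL lactM.
- move=> x c; rewrite JvalR lactM /= lractA.
  (* Centrality of [e] enters here: [(s e) c = s (e c) = s (c e) = c (s e)]. *)
  by congr (_ *> _); rewrite -[RHS](bihomR s) eP.2 (bihomL s).
Defined.

(** The right unit gives [eps (j (s e)) = j e = j]. *)
Lemma unit_splittingP : splitting unit_splitting.
Proof.
move=> j; apply: val_inj => /=; rewrite bihomL (eps_splitting sK).
by rewrite -[in RHS](eP.1 j).
Qed.

Lemma unit_splitting_linear j j' :
  unit_splitting (Jmul j j') = Jval j *> (unit_splitting j' : M).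
Proof. by rewrite /= /unit_splitting_fun JvalM lactM. Qed.

End RightUnit.

Lemma krng_iso_twisted0_matrix (wP : cocycle (bihom0 (tens J J) I)) :
  krng_iso (twisted wP) (matrix_krng eps).
Proof.
pose swap (x : dsum I J) : dsum J I := (x.2, x.1).
have swapD : {morph swap : x y / x + y} by [].
exists (@Bihom k k (dsum I J) (dsum J I) swap swapD
          (fun _ _ => erefl) (fun _ _ => erefl)); split.
  by exists (fun x => (x.2, x.1)) => -[].
by move=> x y; rewrite !kmulE /= /swap /twisted_mul /= addr0.
Qed.

End Splitting.

Lemma krng_iso_trans {k : rngType} {A A' A'' : krng k} :
  krng_iso A A' -> krng_iso A' A'' -> krng_iso A A''.
Proof.
move=> [f [f_bij fM]] [g [g_bij gM]].
have gfD : {morph g \o f : x y / x + y} by move=> x y; rewrite /= !bihomD.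
have gfL c x : (g \o f) (c *> x) = c *> (g \o f) x by rewrite /= !bihomL.
have gfR x c : (g \o f) (x <* c) = (g \o f) x <* c by rewrite /= !bihomR.
exists (@Bihom k k A A'' _ gfD gfL gfR); split; first exact: bij_comp.
by move=> x y; rewrite /= fM gM.
Qed.

Theorem proposition3p2 (k B : rngType) (phi : rngHom k B) (M : bimod B k)
    (eps : bihom M (regular phi)) :
  (exists s : bihom (Jmod eps) (restr phi M),
      forall j : Jmod eps, corestr eps (s j) = j) ->
  (exists (w : bihom (tens (Jmod eps) (Jmod eps)) (Imod eps)) (wP : cocycle w),
      krng_iso (M_krng eps) (twisted wP))
  /\
  ((exists e : Jmod eps, central_right_unit e) ->
      (exists wP : cocycle (bihom0 (tens (Jmod eps) (Jmod eps)) (Imod eps)),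
          krng_iso (M_krng eps) (twisted wP))
      /\ krng_iso (M_krng eps) (matrix_krng eps)).
Proof.
move=> [s sK]; split.
  exists (tens_hom (defect_balanced sK)), (defect_cocycle sK).
  by apply: (splitting_twisted_iso sK) => j j'; rewrite tens_homE.
move=> [e eP].
have iso0 : krng_iso (M_krng eps) (twisted (@cocycle0 _ _ _ _ eps)).
  apply: (splitting_twisted_iso (unit_splittingP sK eP)) => j j'.
  by rewrite unit_splitting_linear subrr.
split; first by exists (@cocycle0 _ _ _ _ eps).
exact: krng_iso_trans iso0 (krng_iso_twisted0_matrix _).
Qed.
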